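(* Let $(M,d)$ be a metric space with more than one element and with a distinguished point $0\in M$. Then the Lipschitz-free space $\mathcal F(M)$ is not almost square. In fact, $\mathcal F(M)$ is not $s$-almost square for any $s$ with $0<s\le 1$.
   Context: All Banach spaces are real. Lipschitz-free space: for a metric space $(M,d)$ with a distinguished point $0\in M$, $\operatorname{Lip}_0(M)$ is the Banach space of all Lipschitz functions $f\colon M\to\mathbb R$ with $f(0)=0$, with norm $\|f\|=\sup\{|f(p)-f(q)|/d(p,q)\colon p,q\in M,\ p\neq q\}$. For $p\in M$ let $\delta_p\in\operatorname{Lip}_0(M)^*$ be given by $\delta_p(f)=f(p)$. The Lipschitz-free space is $\mathcal F(M)=\overline{\operatorname{span}}\{\delta_p\colon p\in M\}\subset\operatorname{Lip}_0(M)^*$, with the norm inherited from $\operatorname{Lip}_0(M)^*$. Almost square and $s$-almost square: for $s\in(0,1]$, a Banach space $X$ with unit sphere $S_X$ is $s$-almost square if for every $\varepsilon>0$ and every finite subset $\{x_1,\dots,x_n\}$ of $S_X$ there exists $y\in S_X$ such that $\|x_i+sy\|\le 1+\varepsilon$ and $\|x_i-sy\|\le 1+\varepsilon$ for every $i\in\{1,\dots,n\}$. The space $X$ is almost square if it is $1$-almost square. *)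

(* Defs.v *)
From HB Require Import structures.
From mathcomp Require Import all_boot all_order all_algebra.
From mathcomp Require Import all_classical all_reals all_analysis.
Set Implicit Arguments.
Unset Strict Implicit.
Unset Printing Implicit Defensive.
Import Order.TTheory GRing.Theory Num.Theory.
Import numFieldNormedType.Exports.
Local Open Scope classical_set_scope.
Local Open Scope ring_scope.

Section LipschitzFunctions.
Context {R : realType} {M : metricType R} (o : M).

Definition lipschitz0 (f : M -> R) : Prop :=
  f o = 0 /\ exists k : R, forall p q, `|f p - f q| <= k * mdist p q.

Definition lip0_pred : {pred M -> R} := [pred f | `[< lipschitz0 f >]].

Record Lip0 := MkLip0 { lip0_fun :> M -> R ; _ : lip0_fun \in lip0_pred }.

HB.instance Definition _ := [isSub for lip0_fun].
HB.instance Definition _ := [Choice of Lip0 by <:].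

Lemma lip0_submod_closed : submod_closed lip0_pred.
Proof.
split=> [|a f g]; rewrite !inE.
  by split=> //; exists 0 => p q; rewrite subrr normr0 mul0r.
move=> [f0 [k fk]] [g0 [l gl]].
have E p : (a *: f + g) p = a * f p + g p by [].
split; first by rewrite E f0 g0 mulr0 addr0.
exists (`|a| * k + l) => p q.
rewrite !E opprD addrACA -mulrBr.
rewrite (le_trans (ler_normD _ _))// mulrDl lerD// normrM -mulrA.
by rewrite ler_wpM2l.
Qed.

HB.instance Definition _ := GRing.isSubmodClosed.Build _ _ lip0_pred
  lip0_submod_closed.
HB.instance Definition _ := [SubChoice_isSubLmodule of Lip0 by <:].

Lemma lip0P (f : Lip0) : lipschitz0 f.
Proof. by case: f => f /= /[!inE]. Qed.

(* The pairs are indexed by pq : M * M.  The quotients are bounded above because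
   f is Lipschitz; if M is a singleton there are none, and sup set0 = 0. *)
Definition lip_norm (f : Lip0) : R :=
  sup [set `|f pq.1 - f pq.2| / mdist pq.1 pq.2 |
        pq in [set pq | pq.1 <> pq.2]].

Lemma lip_norm_ub (f : Lip0) p q : `|f p - f q| <= lip_norm f * mdist p q.
Proof.
have [->|/eqP pq] := eqVneq p q; first by rewrite subrr normr0 mdistxx mulr0.
have d0 : 0 < mdist p q by rewrite mdist_gt0; exact/eqP.
rewrite -ler_pdivrMr//; apply: ub_le_sup; last by exists (p, q).
have [_ [k fk]] := lip0P f; exists k => _ [[x y] /= /eqP xy <-].
by rewrite ler_pdivrMr ?mdist_gt0.
Qed.

Lemma lip_norm_le (f : Lip0) (k : R) : 0 <= k ->
  (forall p q, `|f p - f q| <= k * mdist p q) -> lip_norm f <= k.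
Proof.
move=> k0 fk; rewrite /lip_norm; set S := (X in sup X).
have [->|/set0P S0] := eqVneq S set0; first by rewrite sup0.
apply: ge_sup => // _ [[x y] /= /eqP xy <-].
by rewrite ler_pdivrMr ?mdist_gt0.
Qed.

Lemma lip_norm_ge0 (f : Lip0) : 0 <= lip_norm f.
Proof.
rewrite /lip_norm; set S := (X in sup X).
have [->|/set0P[r Sr]] := eqVneq S set0; first by rewrite sup0.
apply: (@le_trans _ _ r).
  by case: Sr => [pq _ <-]; rewrite divr_ge0 ?mdist_ge0.
apply: ub_le_sup => //; have [_ [k fk]] := lip0P f.
by exists k => _ [[x y] /= /eqP xy <-]; rewrite ler_pdivrMr ?mdist_gt0.
Qed.

Lemma lip_normD (f g : Lip0) : lip_norm (f + g) <= lip_norm f + lip_norm g.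
Proof.
apply: lip_norm_le => [|p q]; first by rewrite addr_ge0 ?lip_norm_ge0.
have E r : (f + g) r = f r + g r by [].
rewrite !E opprD addrACA (le_trans (ler_normD _ _))// mulrDl.
by rewrite lerD ?lip_norm_ub.
Qed.

Lemma lip_normZ (l : R) (f : Lip0) : lip_norm (l *: f) = `|l| * lip_norm f.
Proof.
have E a (g : Lip0) r : (a *: g) r = a * g r by [].
have le a (g : Lip0) : lip_norm (a *: g) <= `|a| * lip_norm g.
  apply: lip_norm_le => [|p q]; first by rewrite mulr_ge0 ?lip_norm_ge0.
  by rewrite !E -mulrBr normrM -mulrA ler_wpM2l ?lip_norm_ub.
apply/eqP; rewrite eq_le le/=.
have [->|l0] := eqVneq l 0; first by rewrite normr0 mul0r lip_norm_ge0.
rewrite -ler_pdivlMl ?normr_gt0// -normfV.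
by rewrite -{1}[f]scale1r -(mulVf l0) -scalerA.
Qed.

Lemma lip_norm_eq0 (f : Lip0) : lip_norm f = 0 -> f = 0.
Proof.
move=> f0; apply/val_inj/funext => p /=.
have := lip_norm_ub f p o; rewrite f0 mul0r normr_le0 subr_eq0 => /eqP ->.
by have [-> _] := lip0P f.
Qed.

HB.instance Definition _ :=
  Lmodule_isNormed.Build R Lip0 lip_normD lip_normZ lip_norm_eq0.

Lemma lip0_normE (f : Lip0) : `|f| = lip_norm f. Proof. by []. Qed.

End LipschitzFunctions.

(* The topological dual of a normed space with its operator norm. *)
Section Dual.
Context {R : realType} {V : normedModType R}.

Definition dual_pred : {pred V -> R} :=
  [pred phi : V -> R | `[< linear phi /\ continuous phi >]].

Record Dual := MkDual { dual_fun :> V -> R ; _ : dual_fun \in dual_pred }.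

HB.instance Definition _ := [isSub for dual_fun].
HB.instance Definition _ := [Choice of Dual by <:].

Lemma dual_submod_closed : submod_closed dual_pred.
Proof.
split=> [|a f g]; rewrite !inE.
  split=> [b x y|]; last exact: cst_continuous.
  by rewrite /GRing.zero/= scaler0 addr0.
move=> [fl fc] [gl gc]; split=> [b x y|x].
  have E z : (a *: f + g) z = a * f z + g z by [].
  rewrite !E fl gl /GRing.scale/= !mulrDr !mulrA (mulrC a b) -!addrA.
  by congr (_ + _); rewrite addrCA.
exact: (cvgD (cvgZl_tmp (fc x)) (gc x)).
Qed.

HB.instance Definition _ := GRing.isSubmodClosed.Build _ _ dual_pred
  dual_submod_closed.
HB.instance Definition _ := [SubChoice_isSubLmodule of Dual by <:].

Lemma dual_linear (phi : Dual) : linear phi.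
Proof. by case: phi => f /= /[!inE] -[]. Qed.

Lemma dual_continuous (phi : Dual) : continuous phi.
Proof. by case: phi => f /= /[!inE] -[]. Qed.

HB.instance Definition _ (phi : Dual) :=
  GRing.isLinear.Build R V R _ phi (dual_linear phi).

Definition dual_norm (phi : Dual) : R :=
  sup [set `|phi x| | x in [set x : V | `|x| <= 1]].

Lemma dual_bounded (phi : Dual) :
  has_ubound [set `|phi x| | x in [set x : V | `|x| <= 1]].
Proof.
have /linear_bounded_continuous/linear_boundedP/pinfty_ex_gt0[k k0 phik] :=
  @dual_continuous phi.
exists k => _ [x /= x1 <-].
by rewrite (le_trans (phik x))// ler_piMr// ltW.
Qed.

Lemma dual_norm_ge0 (phi : Dual) : 0 <= dual_norm phi.
Proof.
apply: ub_le_sup; first exact: dual_bounded.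
by exists 0; rewrite /= ?normr0// linear0 normr0.
Qed.

Lemma dual_norm_ub (phi : Dual) x : `|phi x| <= dual_norm phi * `|x|.
Proof.
have [->|x0] := eqVneq x 0; first by rewrite linear0 !normr0 mulr0.
rewrite -ler_pdivrMr ?normr_gt0//.
apply: ub_le_sup; first exact: dual_bounded.
exists (`|x|^-1 *: x) => /=.
  by rewrite normrZ normfV normr_id mulVf// normr_eq0.
by rewrite linearZ/= normrM normfV normr_id mulrC.
Qed.

Lemma dual_norm_le (phi : Dual) (k : R) : 0 <= k ->
  (forall x, `|phi x| <= k * `|x|) -> dual_norm phi <= k.
Proof.
move=> k0 phik; apply: ge_sup => [|_ [x /= x1 <-]].
  by exists `|phi 0|; exists 0; rewrite //= normr0.
by rewrite (le_trans (phik x))// ler_piMr.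
Qed.

Lemma dual_normD (f g : Dual) : dual_norm (f + g) <= dual_norm f + dual_norm g.
Proof.
apply: dual_norm_le => [|x]; first by rewrite addr_ge0 ?dual_norm_ge0.
have -> : (f + g) x = f x + g x by [].
by rewrite (le_trans (ler_normD _ _))// mulrDl lerD ?dual_norm_ub.
Qed.

Lemma dual_normZ (l : R) (f : Dual) : dual_norm (l *: f) = `|l| * dual_norm f.
Proof.
have le a (g : Dual) : dual_norm (a *: g) <= `|a| * dual_norm g.
  apply: dual_norm_le => [|x]; first by rewrite mulr_ge0 ?dual_norm_ge0.
  have -> : (a *: g) x = a * g x by [].
  by rewrite normrM -mulrA ler_wpM2l ?dual_norm_ub.
apply/eqP; rewrite eq_le le/=.
have [->|l0] := eqVneq l 0; first by rewrite normr0 mul0r dual_norm_ge0.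
rewrite -ler_pdivlMl ?normr_gt0// -normfV.
by rewrite -{1}[f]scale1r -(mulVf l0) -scalerA.
Qed.

Lemma dual_norm_eq0 (f : Dual) : dual_norm f = 0 -> f = 0.
Proof.
move=> f0; apply/val_inj/funext => x /=.
by have := dual_norm_ub f x; rewrite f0 mul0r normr_le0 => /eqP.
Qed.

HB.instance Definition _ :=
  Lmodule_isNormed.Build R Dual dual_normD dual_normZ dual_norm_eq0.

Lemma dual_normE (f : Dual) : `|f| = dual_norm f. Proof. by []. Qed.

End Dual.
Arguments Dual {R} V.

(* The closed linear span of a set as a normed space in its own right, with the
   norm inherited from the ambient space. *)
Section ClosedSpan.
Context {R : realType} {V : normedModType R} (A : set V).

Definition lin_span : set V :=
  [set v | exists n (a : 'I_n -> R) (x : 'I_n -> V),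
     (forall i, A (x i)) /\ v = \sum_(i < n) a i *: x i].

Definition cspan_pred : {pred V} := [pred v | `[< closure lin_span v >]].

Record ClosedSpan := MkClosedSpan {
  cspan_val :> V ; _ : cspan_val \in cspan_pred }.

HB.instance Definition _ := [isSub for cspan_val].
HB.instance Definition _ := [Choice of ClosedSpan by <:].

Lemma lin_spanP a v w : lin_span v -> lin_span w -> lin_span (a *: v + w).
Proof.
move=> [n [b [x [Ax ->]]]] [m [c [y [Ay ->]]]].
exists (n + m)%N.
exists (fun i =>
  match fintype.split i with inl j => a * b j | inr j => c j end).
exists (fun i => match fintype.split i with inl j => x j | inr j => y j end).
split=> [i|]; first by case: fintype.split.
rewrite big_split_ord/= scaler_sumr; congr (_ + _); apply: eq_bigr => i _.
  by rewrite (unsplitK (inl i)) scalerA.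
by rewrite (unsplitK (inr i)).
Qed.

Lemma cspan_submod_closed : submod_closed cspan_pred.
Proof.
split=> [|a v w]; rewrite !inE.
  apply: subset_closure; exists 0%N, (fun=> 0), (fun=> 0).
  by split=> [[]//|]; rewrite big_ord0.
move=> cv cw B Bvw.
have h : (a *: z.1 + z.2) @[z --> (v, w)] --> a *: v + w.
  by apply: cvgD; [apply: cvgZl_tmp; exact: cvg_fst|exact: cvg_snd].
have [[P Q] /= [Pv Qw] PQB] := h _ Bvw.
have [x [Sx Px]] := cv _ Pv; have [y [Sy Qy]] := cw _ Qw.
exists (a *: x + y); split; first exact: lin_spanP.
exact: (PQB (x, y)).
Qed.

HB.instance Definition _ := GRing.isSubmodClosed.Build _ _ cspan_pred
  cspan_submod_closed.
HB.instance Definition _ := [SubChoice_isSubLmodule of ClosedSpan by <:].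

Definition cspan_norm (x : ClosedSpan) : R := `|x : V|.

Lemma cspan_normD x y : cspan_norm (x + y) <= cspan_norm x + cspan_norm y.
Proof. exact: ler_normD. Qed.

Lemma cspan_normZ a x : cspan_norm (a *: x) = `|a| * cspan_norm x.
Proof. exact: normrZ. Qed.

Lemma cspan_norm_eq0 x : cspan_norm x = 0 -> x = 0.
Proof. by move=> /normr0_eq0 x0; exact/val_inj. Qed.

HB.instance Definition _ :=
  Lmodule_isNormed.Build R ClosedSpan cspan_normD cspan_normZ cspan_norm_eq0.

Lemma cspan_normE (x : ClosedSpan) : `|x| = `|x : V|. Proof. by []. Qed.

End ClosedSpan.

Section DualComplete.
Context {R : realType} {V : normedModType R}.

Lemma dual_complete (F : set_system (Dual V)) :
  ProperFilter F -> cauchy F -> cvg F.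
Proof.
move=> FF /cauchyP Fc.
have {}Fc e : 0 < e -> exists2 phi : Dual V,
    F [set psi | `|phi - psi| < e] & True.
  by move=> e0; have [phi Fphi] := Fc _ e0; exists phi.
have evc x : cvg ((fun phi : Dual V => phi x) @ F).
  apply/cauchy_cvgP/cauchyP => e e0.
  have x1 : 0 < `|x| + 1 by rewrite ltr_wpDl.
  have [phi Fphi _] := Fc _ (divr_gt0 e0 x1); exists (phi x).
  rewrite /nbhs/=; apply: filterS Fphi => psi /= phipsi.
  rewrite -ball_normE/=.
  have -> : phi x - psi x = (phi - psi) x by [].
  rewrite (le_lt_trans (dual_norm_ub _ _))// -dual_normE.
  rewrite (@le_lt_trans _ _ (`|phi - psi| * (`|x| + 1)))//.
    by rewrite ler_wpM2l// lerDl.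
  by rewrite -ltr_pdivlMr.
pose L x : R := lim ((fun phi : Dual V => phi x) @ F).
have evL x : (fun phi : Dual V => phi x) @ F --> L x by exact: evc.
have Ll : linear L.
  move=> a x y; apply: cvg_lim => //.
  have -> : (fun phi : Dual V => phi (a *: x + y)) =
      (fun phi : Dual V => a *: phi x + phi y).
    by apply/funext => phi; rewrite linearP.
  by apply: cvgD; [apply: cvgZl_tmp; exact: evL|exact: evL].
have close e : 0 < e ->
    F [set phi : Dual V | forall x, `|phi x - L x| <= e * `|x|].
  move=> e0; have e20 : 0 < e / 2 by rewrite divr_gt0.
  have [phi Fphi _] := Fc _ e20.
  apply: filterS (Fphi) => psi /= phipsi x.
  have cl : closed [set r : R | `|psi x - r| <= e * `|x|].
    apply: (@preimage_closed _ _ (fun r => `|psi x - r|) [set r | r <= e * `|x|]).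
      move=> r _; apply: cvg_norm; apply: cvgB; [exact: cvg_cst|exact: cvg_id].
    exact: closed_le.
  apply: (@closed_cvg _ _ F FF (fun phi : Dual V => phi x) _ cl _ (L x)
    (evL x)).
  apply: filterS Fphi => chi /= phichi.
  have -> : psi x - chi x = (psi - chi) x by [].
  rewrite (le_trans (dual_norm_ub _ _))// -dual_normE ler_wpM2r//.
  rewrite -[psi - chi](subrKA phi) (le_trans (ler_normD _ _))//.
  by rewrite [leRHS]splitr lerD// ltW// distrC.
pose L' := HB.pack_for {linear V -> R} L (GRing.isLinear.Build R V R _ L Ll).
have Ld : L \in dual_pred.
  rewrite inE; split => //.
  apply: (@bounded_linear_continuous _ _ _ L'); apply/linear_boundedP.
  have [phi phiL] := filter_ex (close _ ltr01); near=> r => x /=.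
  rewrite -(subrK (phi x) (L x)) (le_trans (ler_normD _ _))//.
  rewrite (@le_trans _ _ ((1 + `|phi|) * `|x|))//.
    by rewrite mulrDl lerD ?dual_norm_ub// distrC.
  rewrite ler_wpM2r//; near: r; apply: nbhs_pinfty_ge; exact: num_real.
apply/cvg_ex; exists (MkDual Ld).
apply/cvgrPdist_le => e e0; apply: filterS (close _ e0) => phi phiL.
rewrite distrC dual_normE; apply: dual_norm_le; first exact: ltW.
by move=> x; exact: phiL.
Unshelve. all: by end_near. Qed.

HB.instance Definition _ := Uniform_isComplete.Build (Dual V) dual_complete.

End DualComplete.

Section ClosedSpanComplete.
Context {R : realType} {V : completeNormedModType R} (A : set V).

Lemma cspan_complete (F : set_system (ClosedSpan A)) :
  ProperFilter F -> cauchy F -> cvg F.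
Proof.
move=> FF /cauchyP Fc.
have /cvg_ex[l Fl] : cvg ((@cspan_val _ _ A : _ -> V) @ F).
  apply/cauchy_cvgP/cauchyP => e e0.
  have [x Fx] := Fc _ e0; exists (cspan_val x).
  rewrite /nbhs/=; apply: filterS Fx => y.
  by rewrite -!ball_normE.
have lA : l \in cspan_pred A.
  have cl : closed (closure (lin_span A)) by exact: closed_closure.
  rewrite inE.
  apply: (@closed_cvg _ _ F FF (@cspan_val _ _ A) _ cl _ l Fl).
  by apply: nearW => -[x /= /[!inE]].
apply/cvg_ex; exists (MkClosedSpan lA).
apply/cvgrPdist_le => e e0.
by move/cvgrPdist_le : Fl => /(_ _ e0).
Qed.

HB.instance Definition _ :=
  Uniform_isComplete.Build (ClosedSpan A) cspan_complete.

End ClosedSpanComplete.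

Section FreeSpace.
Context {R : realType} {M : metricType R} (o : M).

Definition eval_at (p : M) : Lip0 o -> R := fun f => f p.

Lemma eval_at_dual p : eval_at p \in dual_pred.
Proof.
have l : linear (eval_at p) by [].
pose L := HB.pack_for {linear Lip0 o -> R} (eval_at p)
  (GRing.isLinear.Build R (Lip0 o) R _ (eval_at p) l).
rewrite inE; split => //.
apply: (@bounded_linear_continuous _ _ _ L).
apply/linear_boundedP; near=> r => f.
have [f0 _] := lip0P f; have := lip_norm_ub f p o; rewrite f0 subr0.
move=> /le_trans; apply; rewrite lip0_normE mulrC.
by rewrite ler_wpM2r ?lip_norm_ge0.
Unshelve. all: by end_near. Qed.

Definition delta (p : M) : Dual (Lip0 o) := MkDual (eval_at_dual p).

Definition FreeSpace : completeNormedModType R := ClosedSpan (range delta).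

End FreeSpace.

Section AlmostSquare.
Context {R : realType} (X : completeNormedModType R).

Definition unit_sphere : set X := [set x | `|x| = 1].

(* A = set0 is allowed, so the zero space, whose unit sphere is empty, is not
   almost square; for a nonzero space including A = set0 changes nothing. *)
Definition s_almost_square (s : R) : Prop :=
  forall (e : R) (A : set X), 0 < e -> finite_set A -> A `<=` unit_sphere ->
  exists2 y, unit_sphere y &
    forall x, A x -> `|x + s *: y| <= 1 + e /\ `|x - s *: y| <= 1 + e.

Definition almost_square : Prop := s_almost_square 1.

End AlmostSquare.

(* Main.v *)
Require Import Defs.
From mathcomp Require Import all_boot all_order all_algebra.
From mathcomp Require Import all_classical all_reals all_analysis.
From mathcomp Require Import ring lra.
Set Implicit Arguments.
Unset Strict Implicit.
Unset Printing Implicit Defensive.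
Import Order.TTheory GRing.Theory Num.Theory.
Import numFieldNormedType.Exports.
Local Open Scope classical_set_scope.
Local Open Scope ring_scope.

(** Let [y] be a unit vector with [|m + s *: y|] and [|m - s *: y|] at most [1 + e], where [m] is
    the molecule of a pair [p], [q]. A 1-Lipschitz [f] with [f p - f q = mdist p q] has [m(f) = 1],
    so [s * |y(f)| <= e]: [y] almost vanishes on every function attaining slope 1 at the pair
    ([flat]). One or two well-chosen molecules turn this into [|y| <= 1 / 2], a contradiction
    ([not_s_almost_square]).

    Call the points [u] with [almost_between d p q u] an almost-segment. Some norming function of
    the molecule has slopes bounded away from 1 off the almost-segment, so a small multiple of any
    Lipschitz [g] constant on it can be added without raising the norm above 1; hence [y(g) = O(e)]
    ([flat_small]).

    Three cases are exhaustive. If some almost-segment consists of its two ends, every [f] is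
    constant on it up to a multiple of the norming function ([flat_small_isolated]). If two
    almost-segments are disjoint, a cutoff splits every [f] into two pieces, each constant on one of
    them ([flat_small_disjoint]). Otherwise almost-segments always have a third point and always
    meet, which forces a hub [u] lying almost between any two distinct points ([approx_centre]).
    Then the value of [f] at a point far from [u] can be moved almost freely, and [f] is a convex
    combination of two functions of norm close to 1 with slopes 1 and -1 between that point and [u]
    ([flat_small_star]). *)

(** * Lipschitz functions and a norming function for a pair of points *)

Section Lip0Theory.
Context {R : realType} {M : metricType R} (o : M).
Implicit Types (p q u v : M) (f g : Lip0 o).

Lemma lip0_of_lipschitz (k : R) (F : M -> R) : 0 <= k ->
  (forall u v, `|F u - F v| <= k * mdist u v) ->
  exists2 f : Lip0 o, `|f| <= k & forall u, f u = F u - F o.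
Proof.
move=> k0 Fk; have B u v : (F u - F o) - (F v - F o) = F u - F v by ring.
have fP : (fun u => F u - F o) \in lip0_pred o.
  by rewrite inE; split; [rewrite subrr|exists k => u v; rewrite B].
exists (MkLip0 fP) => //.
by rewrite lip0_normE; apply: lip_norm_le => // u v; rewrite /= B.
Qed.

Lemma lip0_lipschitz (k : R) f u v : `|f| <= k -> `|f u - f v| <= k * mdist u v.
Proof.
move=> fk; apply: le_trans (lip_norm_ub f u v) _.
by rewrite ler_wpM2r// mdist_ge0.
Qed.

Lemma lip0_base f : f o = 0. Proof. by have [] := lip0P f. Qed.

Lemma lip0_eq f g : (forall u, f u = g u) -> f = g.
Proof. by move=> fg; apply/val_inj/funext. Qed.

Definition almost_between (d : R) p q u := mdist p u + mdist q u <= mdist p q + d.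

                                                                            
                                                          
(** A function norming the molecule of [p], [q]: its slope is 1 at the pair, and by [peak_slope] the
    slope between [u] and any other point is at most [mdist p q / (mdist p u + mdist q u)], bounded
    away from 1 when [u] is off an almost-segment. *)
Definition peak p q u : R :=
  mdist p q / 2 * (mdist q u - mdist p u) / (mdist p u + mdist q u).

Lemma mdist_le_sum p q u : mdist p q <= mdist p u + mdist q u.
Proof. by rewrite (metric_sym q u) metric_triangle. Qed.

Lemma peak_slope p q u v : p != q ->
  `|peak p q u - peak p q v| * (mdist p u + mdist q u) <=
    mdist p q * mdist u v.
Proof.
move=> pq; have D0 : 0 < mdist p q by rewrite mdist_gt0.
have Su := mdist_le_sum p q u; have Sv := mdist_le_sum p q v.
have p1 := metric_triangle p u v; have p2 := metric_triangle p v u.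
have q1 := metric_triangle q u v; have q2 := metric_triangle q v u.
rewrite (metric_sym v u) in p2 q2.
have := mdist_ge0 p v; have := mdist_ge0 q v.
rewrite /peak; move: (mdist p q) (mdist p u) (mdist q u) (mdist p v) (mdist q v)
  (mdist u v) D0 Su Sv p1 p2 q1 q2 => D a b a' b' d D0 Su Sv p1 p2 q1 q2 b0 a0.
have S0 : 0 < a + b by lra.
have S'0 : 0 < a' + b' by lra.
rewrite -{2}(gtr0_norm S0) -normrM.
have -> : (D / 2 * (b - a) / (a + b) - D / 2 * (b' - a') / (a' + b')) * (a + b)
    = D * ((b * a' - a * b') / (a' + b')).
  by field; rewrite ?gt_eqF.
rewrite normrM (gtr0_norm D0) ler_pM2l// normrM normfV (gtr0_norm S'0).
rewrite ler_pdivrMr//.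
(* Both brackets are at most [d] in absolute value by the triangle inequality, which leaves the
   factor [a' + b'] of the denominator. *)
have -> : b * a' - a * b' = (b - b') * a' + (a' - a) * b' by ring.
rewrite mulrDr (le_trans (ler_normD _ _))// !normrM.
rewrite (ger0_norm a0) (ger0_norm b0) lerD// ler_wpM2r// ler_norml; lra.
Qed.

Lemma peak_gap p q : p != q -> peak p q p - peak p q q = mdist p q.
Proof.
move=> pq; have D0 : 0 < mdist p q by rewrite mdist_gt0.
rewrite /peak !mdistxx (metric_sym q p); field.
by rewrite gt_eqF.
Qed.

Lemma peak_lipschitz p q u v : p != q ->
  `|peak p q u - peak p q v| <= mdist u v.
Proof.
move=> pq; have D0 : 0 < mdist p q by rewrite mdist_gt0.
have S := mdist_le_sum p q u.
rewrite -(ler_pM2l D0); apply: le_trans (peak_slope u v pq).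
by rewrite mulrC ler_wpM2l.
Qed.

Lemma peak_lipschitz_far (d : R) p q u v : 0 < d -> p != q ->
  ~ almost_between d p q u ->
  `|peak p q u - peak p q v| <= mdist p q / (mdist p q + d) * mdist u v.
Proof.
move=> d0 pq /negP; rewrite -ltNge => far.
have D0 : 0 < mdist p q by rewrite mdist_gt0.
rewrite mulrAC ler_pdivlMr; last by lra.
by apply: le_trans (peak_slope u v pq); rewrite ler_wpM2l// ltW.
Qed.

End Lip0Theory.

(** * Functionals that are flat at a pair, and how small they are *)

Section FlatFunctionals.
Context {R : realType} {M : metricType R} (o : M).
Variables (s e : R).
Hypothesis s_gt0 : 0 < s.
Implicit Types (p q u v : M) (f g : Lip0 o).

                                                                                
                                                                             
(** The outcome of testing both almost-square inequalities for the molecule on an [f] of value 1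
    there ([flat_of_norm_le]). The norm bound [k] stays free because [flat_small_star] tests on
    functions of norm slightly above 1. *)
Definition flat (Phi : Dual (Lip0 o)) p q := forall (k : R) f,
  `|f| <= k -> f p - f q = mdist p q -> s * `|Phi f| <= k * (1 + e) - 1.

Variable Phi : Dual (Lip0 o).

                                                                              
                                                                  
(** With [F] the peak function, [F] and [F + c *: g] both have norm at most 1 and slope 1 at the
    pair: inside the almost-segment [g] contributes nothing, outside it the slope of [F] leaves
    room. Flatness bounds [Phi] at both, hence at their difference [c *: g]. *)
Lemma flat_small (d L : R) p q g : p != q -> flat Phi p q -> 0 < d -> 0 < L ->
  `|g| <= L -> (forall u, almost_between d p q u -> g u = g p) ->
  s * d * `|Phi g| <= 2 * e * L * (mdist p q + d).
Proof.
move=> pq flatPhi d0 L0 gL gA.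
have D0 : 0 < mdist p q by rewrite mdist_gt0.
have gq : g q = g p by apply: gA; rewrite /almost_between mdistxx; lra.
have [F F1 FE] : exists2 F : Lip0 o, `|F| <= 1 &
    forall u, F u = peak p q u - peak p q o.
  by apply: lip0_of_lipschitz => // u v; rewrite mul1r peak_lipschitz.
(* Chosen so that [c * L] is exactly the gap between 1 and the slope [mdist p q / (mdist p q + d)]
   of the peak function off the almost-segment. *)
pose c := d / (mdist p q + d) / L.
have cE : c * L * (mdist p q + d) = d.
  by rewrite /c; field; rewrite !gt_eqF//; lra.
have c0 : 0 < c by rewrite !divr_gt0//; lra.
have far u v : ~ almost_between d p q u ->
    `|(F + c *: g) u - (F + c *: g) v| <= 1 * mdist u v.
  move=> uA; have E w : (F + c *: g) w = F w + c * g w by [].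
  have -> : (F + c *: g) u - (F + c *: g) v =
      (peak p q u - peak p q v) + c * (g u - g v) by rewrite !E !FE; ring.
  rewrite (le_trans (ler_normD _ _))//.
  have -> : 1 = mdist p q / (mdist p q + d) + c * L.
    by rewrite /c; field; rewrite !gt_eqF//; lra.
  rewrite mulrDl lerD ?peak_lipschitz_far// normrM (gtr0_norm c0) -(mulrA c L).
  by rewrite ler_pM2l// lip0_lipschitz.
have G1 : `|F + c *: g| <= 1.
  rewrite lip0_normE; apply: lip_norm_le => // u v.
  have [uA|uA] := pselect (almost_between d p q u); last exact: far.
  have [vA|vA] := pselect (almost_between d p q v); last first.
    by rewrite distrC (metric_sym u v); exact: far.
  have E w : (F + c *: g) w = F w + c * g w by [].
  rewrite !E gA// (gA v)// (_ : _ - _ = F u - F v); last by ring.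
  exact: lip0_lipschitz.
have Fpq : F p - F q = mdist p q by rewrite !FE -(peak_gap pq); ring.
have PF := flatPhi 1 F F1 Fpq.
have PG : s * `|Phi (F + c *: g)| <= 1 * (1 + e) - 1.
  apply: flatPhi => //; have E w : (F + c *: g) w = F w + c * g w by [].
  by rewrite !E gq -Fpq; ring.
have : s * (c * `|Phi g|) <= 2 * e.
  have -> : c * `|Phi g| = `|Phi (F + c *: g) - Phi F|.
    by rewrite linearD linearZ/= addrAC subrr add0r normrM (gtr0_norm c0).
  rewrite (@le_trans _ _ (s * (`|Phi (F + c *: g)| + `|Phi F|)))//.
    by rewrite ler_pM2l// ler_normB.
  by rewrite mulrDr; lra.
have LD0 : 0 < L * (mdist p q + d) by rewrite mulr_gt0//; lra.
rewrite -(ler_pM2r LD0); congr (_ <= _); last by ring.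
by rewrite -[in RHS]cE; ring.
Qed.

(** Being constant on a two-point almost-segment is one linear condition, met after subtracting the
    multiple [a *: F] of the peak function; flatness itself controls [Phi F]. *)
Lemma flat_small_isolated (d : R) p q f : p != q -> flat Phi p q -> 0 < d ->
  (forall u, almost_between d p q u -> u = p \/ u = q) -> `|f| <= 1 ->
  s * `|Phi f| <= (4 * (mdist p q + d) / d + 1) * e.
Proof.
move=> pq flatPhi d0 isol f1.
have D0 : 0 < mdist p q by rewrite mdist_gt0.
have [F F1 FE] : exists2 F : Lip0 o, `|F| <= 1 &
    forall u, F u = peak p q u - peak p q o.
  by apply: lip0_of_lipschitz => // u v; rewrite mul1r peak_lipschitz.
have Fpq : F p - F q = mdist p q by rewrite !FE -(peak_gap pq); ring.
pose a := (f p - f q) / mdist p q.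
have a1 : `|a| <= 1.
  by rewrite normrM normfV (gtr0_norm D0) ler_pdivrMr// lip0_lipschitz.
have g2 : `|f - a *: F| <= 2.
  rewrite (le_trans (ler_normB _ _))// normrZ (_ : 2 = 1 + 1 * 1); last by ring.
  by rewrite lerD// ler_pM.
have E w : (f - a *: F) w = f w - a * F w by [].
have gq : (f - a *: F) q = (f - a *: F) p.
  have : a * (F p - F q) = f p - f q by rewrite Fpq /a divfK// gt_eqF.
  by rewrite !E; lra.
have Pg := flat_small pq flatPhi d0 (ltr0n _ 2) g2 (fun u uA =>
  match isol u uA with or_introl h => congr1 (f - a *: F) h
  | or_intror h => eq_trans (congr1 (f - a *: F) h) gq end).
have PF := flatPhi 1 F F1 Fpq.
have -> : Phi f = Phi (f - a *: F) + a * Phi F.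
  by rewrite linearB linearZ/= subrK.
rewrite (@le_trans _ _ (s * `|Phi (f - a *: F)| + s * `|Phi F|))//.
  rewrite -mulrDr ler_pM2l// (le_trans (ler_normD _ _))// lerD2l normrM.
  by rewrite ler_piMl.
rewrite mulrDl mul1r lerD//; last by lra.
rewrite -(ler_pM2r d0); apply: le_trans (_ : s * d * `|Phi (f - a *: F)| <= _).
  by rewrite mulrAC.
suff -> : 4 * (mdist p q + d) / d * e * d = 2 * e * 2 * (mdist p q + d) by [].
by field; rewrite gt_eqF.
Qed.

Let clamp (x : R) := Num.max 0 (Num.min 1 x).

Let clampP x : [\/ x <= 0 /\ clamp x = 0, 0 <= x <= 1 /\ clamp x = x |
  1 <= x /\ clamp x = 1].
Proof.
rewrite /clamp; case: (leP 1 x) => x1.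
  by constructor 3; split=> //; apply/max_idPr.
case: (leP 0 x) => x0; first by constructor 2; rewrite ltW.
by constructor 1; rewrite ltW.
Qed.

Let clamp_lipschitz x y : `|clamp x - clamp y| <= `|x - y|.
Proof.
wlog xy : x y / x <= y.
  by move=> H; case: (leP x y) => [/H//|/ltW/H]; rewrite distrC (distrC y).
rewrite (distrC x) (ger0_norm (_ : 0 <= y - x)); last by lra.
by rewrite ler_norml; case: (clampP x) => -[? ->]; case: (clampP y) => -[? ->]; lra.
Qed.

Let clamp_itv x : 0 <= clamp x <= 1.
Proof. by case: (clampP x) => -[? ->]; lra. Qed.

(** Localize [f - f p] to the almost-segment of [p], [q] by a cutoff. The localized part [h] is
    constant on the disjoint almost-segment of [p'], [q'], and the rest [f - h] is constant on the
    thinner almost-segment of [p], [q] with tolerance [d / 2], so [flat_small] applies to each. *)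
Lemma flat_small_disjoint (d L : R) p q p' q' f : p != q -> p' != q' ->
  flat Phi p q -> flat Phi p' q' -> 0 < d ->
  (forall u, almost_between d p q u -> ~ almost_between d p' q' u) ->
  `|f| <= 1 ->
  L = 1 + 4 * (mdist p q + d) / d ->
  s * `|Phi f| <=
    (2 * L * (mdist p' q' + d) / d + 4 * (L + 1) * (mdist p q + d / 2) / d) * e.
Proof.
move=> pq p'q' flatPhi flatPhi' d0 disj f1 LE.
have D0 : 0 < mdist p q by rewrite mdist_gt0.
have D'0 : 0 < mdist p' q' by rewrite mdist_gt0.
have lipf u v : `|f u - f v| <= mdist u v.
  by rewrite -[leRHS]mul1r lip0_lipschitz.
have L1 : 1 < L by rewrite LE ltrDl divr_gt0// mulr_gt0//; lra.
(* The cutoff is 1 at tolerance [d / 2] and 0 beyond tolerance [d]; its constant [4 / d] is [2 / d]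
   times the constant 2 of a sum of two distances. *)
pose psi u := clamp ((mdist p q + d - (mdist p u + mdist q u)) * (2 / d)).
have psi01 u : 0 <= psi u <= 1 by exact: clamp_itv.
have psiL u v : `|psi u - psi v| <= 4 / d * mdist u v.
  apply: le_trans (clamp_lipschitz _ _) _.
  rewrite -mulrBl normrM (gtr0_norm (_ : 0 < 2 / d)) ?divr_gt0//.
  have -> : 4 / d * mdist u v = (mdist u v + mdist u v) * (2 / d) by field; rewrite gt_eqF.
  rewrite ler_pM2r ?divr_gt0// ler_norml.
  have := metric_triangle p u v; have := metric_triangle q u v.
  have := metric_triangle p v u; have := metric_triangle q v u.
  by rewrite (metric_sym v u); lra.
have psi_out u : ~ almost_between d p q u -> psi u = 0.
  move=> /negP; rewrite -ltNge => uA.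
  rewrite /psi; set x := _ * _.
  have x0 : x < 0 by rewrite pmulr_llt0 ?divr_gt0//; lra.
  by case: (clampP x) => -[? ->]; lra.
have psi_in u : almost_between (d / 2) p q u -> psi u = 1.
  rewrite /almost_between => uA; rewrite /psi; set x := _ * _.
  have x1 : 1 <= x by rewrite /x mulrA ler_pdivlMr//; lra.
  by case: (clampP x) => -[? ->]; lra.
(* Subtracting [f p] keeps the second factor below [mdist p q + d] where [psi] lives, which gives
   the Lipschitz constant [L]. *)
pose H u := psi u * (f u - f p).
have near u v : almost_between d p q u -> `|H u - H v| <= L * mdist u v.
  move=> uA.
  have -> : H u - H v = (psi u - psi v) * (f u - f p) + psi v * (f u - f v).
    by rewrite /H; ring.
  rewrite (le_trans (ler_normD _ _))// !normrM.
  rewrite LE mulrDl addrC lerD//.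
    by have /andP[v0 v1] := psi01 v; rewrite ler_pM// ger0_norm.
  have -> : 4 * (mdist p q + d) / d * mdist u v =
      4 / d * mdist u v * (mdist p q + d) by ring.
  rewrite ler_pM//; apply: le_trans (lipf _ _) _.
  have := mdist_ge0 q u; move: uA; rewrite /almost_between (metric_sym u p); lra.
have HL u v : `|H u - H v| <= L * mdist u v.
  have [uA|uA] := pselect (almost_between d p q u); first exact: near.
  have [vA|vA] := pselect (almost_between d p q v).
    by rewrite distrC metric_sym; exact: near.
  rewrite /H !psi_out// !mul0r subrr normr0 mulr_ge0 ?mdist_ge0//; lra.
have [|h hL hE] := lip0_of_lipschitz o _ HL; first by lra.
have fhL : `|f - h| <= L + 1 by rewrite (le_trans (ler_normB _ _))// addrC lerD.
have Ph : s * d * `|Phi h| <= 2 * e * L * (mdist p' q' + d).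
  apply: flat_small => //; first by lra.
  have H0 u : almost_between d p' q' u -> H u = 0.
    by move=> u'A; rewrite /H psi_out ?mul0r// => /disj.
  move=> u u'A; rewrite !hE (H0 u)// (H0 p')//.
  rewrite /almost_between mdistxx (metric_sym q'); lra.
have Pfh : s * (d / 2) * `|Phi (f - h)| <=
    2 * e * (L + 1) * (mdist p q + d / 2).
  apply: (flat_small pq) => //; [by rewrite divr_gt0|by rewrite addr_gt0//; lra|].
  move=> v vA; have E w : (f - h) w = f w - h w by [].
  rewrite !E !hE /H (psi_in v)// (psi_in p); first ring.
  rewrite /almost_between mdistxx (metric_sym q); lra.
have -> : Phi f = Phi h + Phi (f - h) by rewrite linearB/= addrC subrK.
rewrite (@le_trans _ _ (s * `|Phi h| + s * `|Phi (f - h)|))//.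
  by rewrite -mulrDr ler_pM2l// ler_normD.
rewrite -(ler_pM2r d0).
have -> : (2 * L * (mdist p' q' + d) / d + 4 * (L + 1) * (mdist p q + d / 2) / d) * e * d
  = 2 * e * L * (mdist p' q' + d) + 2 * (2 * e * (L + 1) * (mdist p q + d / 2)).
  by field; rewrite gt_eqF.
rewrite (_ : _ * d = s * d * `|Phi h| + 2 * (s * (d / 2) * `|Phi (f - h)|)).
  by rewrite lerD// ler_pM2l.
by field.
Qed.

                                                                              
                                                                         
(** Every path out of [q] almost passes through [u], so the value at [q] is constrained essentially
    only by the value at [u]. Resetting it to [f u] plus or minus [mdist q u] costs a factor [1 + t]
    in the norm, and [f] lies on the segment between the two resulting functions. *)
Lemma flat_small_star (d t : R) q u f : q != u -> flat Phi q u -> 0 <= d ->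
  0 <= t -> d <= t * (mdist q u - d) ->
  (forall x, x != q -> mdist q u + mdist u x <= mdist q x + d) ->
  `|f| <= 1 -> s * `|Phi f| <= (1 + t) * (1 + e) - 1.
Proof.
move=> qu flatPhi d0 t0 dt star f1.
have D0 : 0 < mdist q u by rewrite mdist_gt0.
have uq : u != q by rewrite eq_sym.
pose G (r : R) x := if x == q then f u + r else f x.
have Gq r x : `|r| <= mdist q u -> x != q ->
    `|G r q - G r x| <= (1 + t) * mdist q x.
  move=> rD xq; rewrite /G eqxx (negbTE xq).
  have -> : f u + r - f x = r + (f u - f x) by ring.
  rewrite (le_trans (ler_normD _ _))//.
  have := lip0_lipschitz u x f1; have := star x xq; have := mdist_ge0 u x.
  (* The additive defect [d] becomes multiplicative: [d <= t * (mdist q u - d) <= t * mdist q x]. *)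
  have : t * (mdist q u - d) <= t * mdist q x.
    by rewrite ler_wpM2l//; have := star x xq; have := mdist_ge0 u x; lra.
  by lra.
have GL r : `|r| <= mdist q u ->
    forall x y, `|G r x - G r y| <= (1 + t) * mdist x y.
  move=> rD x y.
  have [->|xq] := eqVneq x q.
    have [->|yq] := eqVneq y q; last exact: Gq.
    by rewrite subrr normr0 mdistxx mulr0.
  have [->|yq] := eqVneq y q; first by rewrite distrC metric_sym; exact: Gq.
  rewrite /G (negbTE xq) (negbTE yq) (le_trans (lip0_lipschitz _ _ f1))//.
  by rewrite ler_wpM2r ?mdist_ge0//; lra.
have t1 : 0 <= 1 + t by lra.
have [|F1 F1t F1E] := lip0_of_lipschitz o t1 (GL (mdist q u) _).
  by rewrite gtr0_norm.
have [|F2 F2t F2E] := lip0_of_lipschitz o t1 (GL (- mdist q u) _).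
  by rewrite normrN gtr0_norm.
have P1 : s * `|Phi F1| <= (1 + t) * (1 + e) - 1.
  by apply: flatPhi => //; rewrite !F1E /G eqxx (negbTE uq); ring.
have P2 : s * `|Phi F2| <= (1 + t) * (1 + e) - 1.
  rewrite -normrN -linearN; apply: flatPhi; first by rewrite normrN.
  have E w : (- F2) w = - F2 w by [].
  by rewrite !E !F2E /G eqxx (negbTE uq); ring.
(* The weight that gives the combination the value [f q] at [q]; it lies in [0, 1] because [f] is
   1-Lipschitz. *)
pose l := (1 + (f q - f u) / mdist q u) / 2.
have /andP[l0 l1] : 0 <= l <= 1.
  have : `|(f q - f u) / mdist q u| <= 1.
    by rewrite normrM normfV (gtr0_norm D0) ler_pdivrMr// lip0_lipschitz.
  by rewrite ler_norml /l; lra.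
have lE : l * mdist q u - (1 - l) * mdist q u = f q - f u.
  by rewrite /l; field; rewrite gt_eqF.
clearbody l.
have GE x : l * G (mdist q u) x + (1 - l) * G (- mdist q u) x = f x.
  rewrite /G; case: eqP => [->|_]; last by ring.
  by rewrite -[RHS](subrK (f u)) -lE; ring.
have -> : f = l *: F1 + (1 - l) *: F2.
  apply: lip0_eq => x.
  have -> : (l *: F1 + (1 - l) *: F2) x = l * F1 x + (1 - l) * F2 x by [].
  rewrite F1E F2E -(subr0 (f x)) -(lip0_base f) -(GE x) -(GE o); ring.
have -> : Phi (l *: F1 + (1 - l) *: F2) = l * Phi F1 + (1 - l) * Phi F2.
  by rewrite linearD !linearZ.
have l1' : 0 <= 1 - l by lra.
apply: le_trans (_ : l * (s * `|Phi F1|) + (1 - l) * (s * `|Phi F2|) <= _).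
  rewrite !(mulrCA _ s) -mulrDr ler_pM2l// (le_trans (ler_normD _ _))//.
    by rewrite !normrM (ger0_norm l0) (ger0_norm l1').
apply: le_trans (_ : l * ((1 + t) * (1 + e) - 1) + (1 - l) * ((1 + t) * (1 + e) - 1) <= _).
  by rewrite lerD// ler_wpM2l//; lra.
by rewrite -mulrDl subrKC mul1r.
Qed.

End FlatFunctionals.

(** * Molecules, and the reduction to flat functionals *)

Section Molecules.
Context {R : realType} {M : metricType R} (o : M).
Implicit Types p q : M.

Lemma delta_cspan p : delta o p \in cspan_pred (range (delta o)).
Proof.
rewrite inE; apply: subset_closure; exists 1%N, (fun=> 1), (fun=> delta o p).
by split=> [i|]; [exists p|rewrite big_ord1 scale1r].
Qed.

Definition molecule p q : FreeSpace o :=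
  (mdist p q)^-1 *: (MkClosedSpan (delta_cspan p) - MkClosedSpan (delta_cspan q)).

Lemma molecule_val p q (f : Lip0 o) :
  cspan_val (molecule p q) f = (mdist p q)^-1 * (f p - f q).
Proof. by []. Qed.

Lemma free_addZE (x y : FreeSpace o) (a : R) (f : Lip0 o) :
  cspan_val (x + a *: y) f = cspan_val x f + a * cspan_val y f.
Proof.
have -> : cspan_val (x + a *: y) = cspan_val x + cspan_val (a *: y) by [].
have -> : cspan_val (a *: y) = a *: cspan_val y by [].
have DE (g h : Dual (Lip0 o)) : (g + h) f = g f + h f by [].
have ZE (g : Dual (Lip0 o)) : (a *: g) f = a * g f by [].
by rewrite DE ZE.
Qed.

Lemma norm_molecule p q : p != q -> `|molecule p q| = 1.
Proof.
move=> pq; have D0 : 0 < mdist p q by rewrite mdist_gt0.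
rewrite cspan_normE dual_normE; apply/eqP; rewrite eq_le; apply/andP; split.
  apply: dual_norm_le => // f.
  rewrite molecule_val normrM normfV (gtr0_norm D0) ler_pdivrMl// mul1r mulrC.
  exact: lip0_lipschitz.
have [F F1 FE] : exists2 F : Lip0 o, `|F| <= 1 &
    forall u, F u = peak p q u - peak p q o.
  by apply: lip0_of_lipschitz => // u v; rewrite mul1r peak_lipschitz.
apply: (@le_trans _ _ (dual_norm (cspan_val (molecule p q)) * `|F|)); last first.
  by rewrite ler_piMr ?dual_norm_ge0.
apply: le_trans (dual_norm_ub _ F).
rewrite molecule_val !FE (_ : _ - _ = mdist p q); last by rewrite -(peak_gap pq); ring.
by rewrite mulVf ?normr1// gt_eqF.
Qed.

Lemma flat_of_norm_le (s e : R) p q (y : FreeSpace o) : 0 < s -> p != q ->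
  `|molecule p q + s *: y| <= 1 + e -> `|molecule p q - s *: y| <= 1 + e ->
  flat s e (cspan_val y) p q.
Proof.
move=> s0 pq yD yB k f fk fpq.
have D0 : 0 < mdist p q by rewrite mdist_gt0.
have m1 : (mdist p q)^-1 * (f p - f q) = 1 by rewrite fpq mulVf ?gt_eqF.
have Phi_le (z : FreeSpace o) : `|z| <= 1 + e -> cspan_val z f <= k * (1 + e).
  move=> ze; apply: le_trans (ler_norm _) _.
  apply: le_trans (dual_norm_ub _ f) _; rewrite mulrC ler_pM//.
  exact: dual_norm_ge0.
have {}yD := Phi_le _ yD; have {}yB := Phi_le _ yB.
rewrite free_addZE molecule_val m1 in yD.
rewrite -scaleNr free_addZE molecule_val m1 in yB.
rewrite -{1}(gtr0_norm s0) -normrM ler_norml.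
by lra.
Qed.

Lemma not_s_almost_square (s e : R) p q p' q' : 0 < s -> 0 < e ->
  p != q -> p' != q' ->
  (forall Phi : Dual (Lip0 o), flat s e Phi p q -> flat s e Phi p' q' ->
    forall f : Lip0 o, `|f| <= 1 -> s * `|Phi f| <= s / 2) ->
  ~ s_almost_square (FreeSpace o) s.
Proof.
move=> s0 e0 pq p'q' small asq.
have [||y y1 yE] := asq e [set molecule p q; molecule p' q'] e0.
- by rewrite finite_setU; split; exact: finite_set1.
- by move=> _ [->|->]; exact: norm_molecule.
have [yD yB] := yE _ (or_introl erefl); have [y'D y'B] := yE _ (or_intror erefl).
have : `|y| <= 1 / 2.
  rewrite cspan_normE dual_normE; apply: ge_sup => [|_ [f /= f1 <-]].
    by exists `|cspan_val y 0|; exists 0; rewrite //= normr0.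
  rewrite -(ler_pM2l s0) mul1r; apply: small => //.
    exact: flat_of_norm_le.
  exact: flat_of_norm_le.
by rewrite (y1 : `|y| = 1) ler_pdivlMr// mul1r lern1.
Qed.

(** Since [K] does not depend on [e], taking [e = s / (2 * K)] brings the bound down to [s / 2]. *)
Lemma not_s_almost_square_linear (s K : R) p q p' q' : 0 < s -> 0 < K ->
  p != q -> p' != q' ->
  (forall e (Phi : Dual (Lip0 o)), flat s e Phi p q ->
    flat s e Phi p' q' ->
    forall f : Lip0 o, `|f| <= 1 -> s * `|Phi f| <= K * e) ->
  ~ s_almost_square (FreeSpace o) s.
Proof.
move=> s0 K0 pq p'q' small.
have e0 : 0 < s / 2 / K by rewrite !divr_gt0.
apply: (not_s_almost_square s0 e0 pq p'q') => Phi flatPhi flatPhi' f f1.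
by apply: le_trans (small _ _ flatPhi flatPhi' f f1) _; rewrite mulrC divfK// gt_eqF.
Qed.

End Molecules.

(** * An approximate hub when almost-segments always meet *)

Section Dichotomy.
Context {R : realType} {M : metricType R}.
Implicit Types a b p q u v : M.

Lemma approx_centre (d : R) p q : 0 < d -> p != q ->
  (forall e a b, 0 < e -> a != b ->
    exists2 u, almost_between e a b u & u != a /\ u != b) ->
  (forall e a b a' b', 0 < e -> a != b -> a' != b' ->
    exists2 u, almost_between e a b u & almost_between e a' b' u) ->
  exists u, forall a b, a != b -> mdist a u + mdist u b <= mdist a b + d.
Proof.
move=> d0 pq third common.
have e0 : 0 < d / 8 by rewrite divr_gt0.
have [u puq [up uq]] := third _ _ _ e0 pq.
have pu : p != u by rewrite eq_sym.
have [w pwu [wp wu]] := third _ _ _ e0 pu.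
have pw : p != w by rewrite eq_sym.
have [v pvw uvq] := common _ _ _ _ _ e0 pw uq.
(* The points [p], [w], [u], [q] are almost aligned in this order, yet [v] is almost between [p],
   [w] and almost between [u], [q]; adding the four estimates shrinks the gap from [w] to [u]. *)
have uw : mdist u w <= d / 4.
  move: puq pwu pvw uvq; rewrite /almost_between.
  have := metric_triangle p v q; have := metric_triangle u v w.
  rewrite (metric_sym u v) (metric_sym q u) (metric_sym q v) (metric_sym w v).
  by have := mdist_ge0 w v; lra.
exists u => a b ab.
rewrite eq_sym in wu.
(* Here [x] is within [3 * d / 8] of [u], so a detour from [x] to [u] adds at most [6 * d / 8] to
   the defect [d / 8]. *)
have [x axb uxw] := common _ _ _ _ _ e0 ab wu.
move: axb uxw; rewrite /almost_between.
have := metric_triangle a x u; have := metric_triangle u x b.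
rewrite (metric_sym x u) (metric_sym x b).
by have := mdist_ge0 w x; lra.
Qed.

End Dichotomy.

(** * The three cases combined *)

Lemma free_space_not_s_almost_square (R : realType) (M : metricType R) (o p q : M)
  (s : R) : p != q -> 0 < s <= 1 -> ~ s_almost_square (FreeSpace o) s.
Proof.
move=> pq /andP[s0 s1].
have [third|] := pselect (forall e (a b : M), 0 < e -> a != b ->
    exists2 u, almost_between e a b u & u != a /\ u != b); last first.
  move=> /existsNP[d /existsNP[a /existsNP[b /not_implyP[d0 /not_implyP[ab isol]]]]].
  have D0 : 0 < mdist a b by rewrite mdist_gt0.
  have K0 : 0 < 4 * (mdist a b + d) / d + 1.
    by rewrite addr_gt0// divr_gt0// mulr_gt0// addr_gt0.
  (* One molecule is enough here, so the same pair is supplied twice. *)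
  apply: (not_s_almost_square_linear s0 K0 ab ab) => e Phi flatPhi _ f f1.
  apply: (flat_small_isolated s0 ab flatPhi d0) => // u abu.
  have [ua|ua] := eqVneq u a; first by left.
  by have [ub|ub] := eqVneq u b; [right|case: isol; exists u].
have [common|] := pselect (forall e (a b a' b' : M), 0 < e -> a != b -> a' != b' ->
    exists2 u, almost_between e a b u & almost_between e a' b' u); last first.
  move=> /existsNP[d /existsNP[a /existsNP[b /existsNP[a' /existsNP[b']]]]].
  move=> /not_implyP[d0 /not_implyP[ab /not_implyP[a'b' disj]]].
  have D0 : 0 < mdist a b by rewrite mdist_gt0.
  have D'0 : 0 < mdist a' b' by rewrite mdist_gt0.
  pose L := 1 + 4 * (mdist a b + d) / d.
  have L0 : 0 < L by rewrite addr_gt0// divr_gt0// mulr_gt0// addr_gt0.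
  have K0 : 0 < 2 * L * (mdist a' b' + d) / d +
      4 * (L + 1) * (mdist a b + d / 2) / d.
    have h1 : 0 < mdist a' b' + d by rewrite addr_gt0.
    have h2 : 0 < mdist a b + d / 2 by lra.
    have h3 : 0 < L + 1 by rewrite addr_gt0.
    by apply: addr_gt0; rewrite divr_gt0// !mulr_gt0.
  apply: (not_s_almost_square_linear s0 K0 ab a'b') => e Phi flatPhi flatPhi' f f1.
  apply: (flat_small_disjoint s0 ab a'b' flatPhi flatPhi' d0) => // u uA u'A.
  by case: disj; exists u.
have D0 : 0 < mdist p q by rewrite mdist_gt0.
(* With [t = e = s / 8] and [mdist r u >= mdist p q / 2], this defect satisfies
   [d <= t * (mdist r u - d)], and the final bound [(1 + s / 8) ^ 2 - 1] is at most [s / 2]. *)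
have d0 : 0 < s * mdist p q / 32 by rewrite divr_gt0// mulr_gt0.
have [u star] := approx_centre d0 pq third common.
have sD : s * mdist p q <= mdist p q by rewrite ler_piMl// ltW.
(* The hub cannot be close to both [p] and [q]; the farther one serves as the tip of the star. *)
have [r ru] : exists r, mdist p q <= 2 * mdist r u.
  have [h|h] := leP (mdist q u) (mdist p u); [exists p|exists q];
    have := metric_triangle p u q; rewrite (metric_sym u q); lra.
have rneu : r != u by rewrite -mdist_gt0; lra.
have e0 : 0 < s / 8 by rewrite divr_gt0.
apply: (not_s_almost_square s0 e0 rneu rneu) => Phi flatPhi _ f f1.
apply: le_trans
  (flat_small_star s0 rneu flatPhi (ltW d0) (ltW e0) _ _ f1) _.
- have : s / 8 * (mdist p q / 4) <= s / 8 * (mdist r u - s * mdist p q / 32).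
    by rewrite ler_pM2l//; lra.
  by lra.
- by move=> x xr; apply: star; rewrite eq_sym.
have ss : s * s <= s by rewrite ler_piMl// ltW.
by lra.
Qed.

Theorem theorem4p1 (R : realType) (M : metricType R) (o : M)
    (hM : exists p q : M, p <> q) :
  ~ almost_square (FreeSpace o) /\
  (forall s : R, 0 < s <= 1 -> ~ s_almost_square (FreeSpace o) s).
Proof.
have [p [q /eqP pq]] := hM.
have nsas s : 0 < s <= 1 -> ~ s_almost_square (FreeSpace o) s.
  exact: free_space_not_s_almost_square pq.
by split=> //; apply: nsas; rewrite ltr01 lexx.
Qed.
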